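(* Let $\gamma:I\to G_3^1$ be a Frenet curve of osculating order $3$ in the equiform geometry of the pseudo-Galilean space $G_3^1$, with equiform curvature $\mathcal{K}$ and equiform torsion $\mathcal{T}$. Then: (i) $\gamma$ is of type weak equiform AW$(2)$ if and only if $2\mathcal{K}^2+\mathcal{T}^2-\mathcal{K}'=0$; (ii) $\gamma$ is of type weak equiform AW$(3)$ if and only if $\mathcal{T}'-3\mathcal{K}\mathcal{T}=0$. Here $'$ on $\mathcal{K},\mathcal{T}$ denotes the derivative with respect to the equiform parameter $\sigma$.
   Context: Pseudo-Galilean space. $G_3^1$ is $\mathbb{R}^3$ with the scalar product $\langle u,v\rangle=u_1v_1$ if $u_1\neq0$ or $v_1\neq 0$, and $\langle u,v\rangle=u_2v_2-u_3v_3$ if $u_1=v_1=0$. Curves. Curves are sufficiently smooth admissible curves (no inflection points, no isotropic tangents, no lightlike principal normals), parametrized by arc length $s=x$: $\gamma(s)=(s,y(s),z(s))$ with $y''(s)\neq\pm z''(s)$ for all $s$ in an interval $I$. The curvature and torsion are $\kappa=\sqrt{|y''^2-z''^2|}>0$ and $\tau=(y''z'''-y'''z'')/\kappa^2$. The trihedron is $\mathbf{e}_1=(1,y',z')$, $\mathbf{e}_2=\frac1\kappa(0,y'',z'')$, $\mathbf{e}_3=\frac1\kappa(0,\epsilon z'',\epsilon y'')$, where $\epsilon=\pm1$ satisfies $|y''^2-z''^2|=\epsilon(y''^2-z''^2)$. It satisfies $\mathbf{e}_1'=\kappa\mathbf{e}_2$, $\mathbf{e}_2'=\tau\mathbf{e}_3$,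 $\mathbf{e}_3'=\tau\mathbf{e}_2$. Equiform geometry. Let $\rho=1/\kappa$. The equiform parameter is $\sigma=\int\kappa\,ds$. The equiform frame is $\mathbf{T}=\rho\mathbf{e}_1$, $\mathbf{N}=\rho\mathbf{e}_2$, $\mathbf{B}=\rho\mathbf{e}_3$. The equiform curvature is $\mathcal{K}=d\rho/ds$ and the equiform torsion is $\mathcal{T}=\rho\tau=\tau/\kappa$. Below, $\mathcal{K}'=d\mathcal{K}/d\sigma$ and $\mathcal{T}'=d\mathcal{T}/d\sigma$. Osculating order. A Frenet curve of osculating order $3$ is a curve for which the $s$-derivatives $\gamma',\gamma'',\gamma'''$ are linearly independent and $\gamma',\gamma'',\gamma''',\gamma''''$ are no longer linearly independent, for all $s\in I$. Weak AW types. Put $Q_1=\frac{1}{\rho^2}\mathbf{N}$, $Q_2=\frac1{\rho^3}(-\mathcal{K}\mathbf{N}+\mathcal{T}\mathbf{B})$, $Q_3=\frac1{\rho^4}[(2\mathcal{K}^2+\mathcal{T}^2-\mathcal{K}')\mathbf{N}+(\mathcal{T}'-3\mathcal{K}\mathcal{T})\mathbf{B}]$. Write $\|v\|^2=\langle v,v\rangle$, where $\|v\|$ is a possibly imaginary square root and $\langle\cdot,\cdot\rangle$ is extended complex-bilinearly; the conditions below do not depend on the choice of root. Put $Q_1^*=\frac{Q_1}{\|Q_1\|}$ and $Q_2^*=\frac{Q_2-\langle Q_2,Q_1^*\rangle Q_1^*}{\|Q_2-\langle Q_2,Q_1^*\rangle Q_1^*\|}$. A Frenet curve of osculating order $3$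 is of type weak equiform AW$(2)$ if $Q_3=\langle Q_3,Q_2^*\rangle Q_2^*$ for all $s\in I$, and of type weak equiform AW$(3)$ if $Q_3=\langle Q_3,Q_1^*\rangle Q_1^*$ for all $s\in I$. *)

(* Defs.v *)
From Stdlib Require Import Reals Lra.
From Coquelicot Require Import Coquelicot.
Open Scope R_scope.

Notation R3 := (R * R * R)%type.
Notation C3 := (C * C * C)%type.

(** ** Scalar product of the pseudo-Galilean space *)

(* The real scalar product is the restriction of this one to real vectors.
   On isotropic vectors (first component 0) it is complex-bilinear. *)
Definition pg_prod (u v : C3) : C :=
  let '(u1, u2, u3) := u in
  let '(v1, v2, v3) := v in
  if Ceq_dec u1 (RtoC 0) then
    if Ceq_dec v1 (RtoC 0) then (u2 * v2 - u3 * v3)%C else (u1 * v1)%C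
  else (u1 * v1)%C.

Definition toC3 (u : R3) : C3 :=
  let '(u1, u2, u3) := u in (RtoC u1, RtoC u2, RtoC u3).

(* Principal square root; it is [Ci * sqrt (- r)] at a negative real [r]. *)
Definition Csqrt (w : C) : C :=
  (sqrt ((Cmod w + Re w) / 2),
   (if Rlt_dec (Im w) 0 then -1 else 1) * sqrt ((Cmod w - Re w) / 2)).

Lemma Csqrt_sqr (w : C) : (Csqrt w * Csqrt w)%C = w.
Proof.
destruct w as [a b]; unfold Csqrt, Cmult; simpl.
set (m := Cmod (a, b)).
assert (Hm0 : 0 <= m) by apply Cmod_ge_0.
assert (Hm : m * m = a * a + b * b).
{ unfold m, Cmod; simpl; rewrite sqrt_sqrt; nra. }
assert (Hp : 0 <= (m + a) / 2) by nra.
assert (Hq : 0 <= (m - a) / 2) by nra.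
assert (Hprod : sqrt ((m + a) / 2) * sqrt ((m - a) / 2) = Rabs b / 2).
{ rewrite <- sqrt_mult by assumption.
  replace ((m + a) / 2 * ((m - a) / 2)) with (Rsqr (b / 2))
    by (unfold Rsqr; nra).
  rewrite sqrt_Rsqr_abs; unfold Rdiv; rewrite Rabs_mult.
  rewrite (Rabs_pos_eq (/ 2)); lra. }
pose proof (sqrt_sqrt _ Hp) as Ep.
pose proof (sqrt_sqrt _ Hq) as Eq.
destruct (Rlt_dec b 0) as [Hb | Hb].
- rewrite Rabs_left in Hprod by assumption; f_equal; nra.
- rewrite Rabs_pos_eq in Hprod by lra; f_equal; nra.
Qed.

Definition pg_norm (v : C3) : C := Csqrt (pg_prod v v).

Definition pg_normalize (v : C3) : C3 := scal (/ pg_norm v)%C v.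

(** ** Curves [s |-> (s, y s, z s)] *)

Definition is_interval (I : R -> Prop) : Prop :=
  (exists a b, a < b /\ I a /\ I b) /\
  forall a b t, I a -> I b -> a <= t <= b -> I t.

(* The functions are total; at an endpoint belonging to [I] this asks for a
   C^4 extension, whose derivatives at the endpoint are then determined by the
   values on [I]. *)
Definition C4_on (I : R -> Prop) (f : R -> R) : Prop :=
  forall s, I s ->
    locally s (fun t => (forall k, (k <= 4)%nat -> ex_derive_n f k t) /\
                        continuous (Derive_n f 4) t).

Definition admissible (I : R -> Prop) (y z : R -> R) : Prop :=
  forall s, I s ->
    Derive_n y 2 s <> Derive_n z 2 s /\ Derive_n y 2 s <> - Derive_n z 2 s.

Definition gamma_deriv (y z : R -> R) (k : nat) (s : R) : R3 :=
  (Derive_n (fun t => t) k s, Derive_n y k s, Derive_n z k s).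

(* Linear independence of [v 1, ..., v n]. *)
Definition lin_indep (n : nat) (v : nat -> R3) : Prop :=
  forall a : nat -> R,
    sum_n_m (fun i => scal (a i) (v i)) 1 n = zero ->
    forall i, (1 <= i <= n)%nat -> a i = 0.

Definition osculating_order3 (I : R -> Prop) (y z : R -> R) : Prop :=
  forall s, I s ->
    lin_indep 3 (fun k => gamma_deriv y z k s) /\
    ~ lin_indep 4 (fun k => gamma_deriv y z k s).

Definition Frenet_curve3 (I : R -> Prop) (y z : R -> R) : Prop :=
  C4_on I y /\ C4_on I z /\ admissible I y z /\ osculating_order3 I y z.

(** ** Pseudo-Galilean invariants *)

Definition kappa (y z : R -> R) (s : R) : R :=
  sqrt (Rabs ((Derive_n y 2 s) ^ 2 - (Derive_n z 2 s) ^ 2)).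

Definition tau (y z : R -> R) (s : R) : R :=
  (Derive_n y 2 s * Derive_n z 3 s - Derive_n y 3 s * Derive_n z 2 s)
  / (kappa y z s) ^ 2.

(* +1 or -1 on admissible curves. *)
Definition eps (y z : R -> R) (s : R) : R :=
  sign ((Derive_n y 2 s) ^ 2 - (Derive_n z 2 s) ^ 2).

Definition e1 (y z : R -> R) (s : R) : R3 := (1, Derive y s, Derive z s).

Definition e2 (y z : R -> R) (s : R) : R3 :=
  scal (1 / kappa y z s) ((0, Derive_n y 2 s, Derive_n z 2 s) : R3).

Definition e3 (y z : R -> R) (s : R) : R3 :=
  scal (1 / kappa y z s)
    ((0, eps y z s * Derive_n z 2 s, eps y z s * Derive_n y 2 s) : R3).

(** ** Equiform invariants *)

Definition rho (y z : R -> R) (s : R) : R := 1 / kappa y z s.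

(* The equiform parameter is an indefinite integral; [s0] in the interval
   fixes the constant of integration. *)
Definition sigma (y z : R -> R) (s0 s : R) : R := RInt (kappa y z) s0 s.

(* Derivative at [s] of [F] with respect to the parameter [p]. *)
Definition Derive_wrt (p F : R -> R) (s : R) : R :=
  real (Lim (fun t => (F t - F s) / (p t - p s)) s).

Definition eqT (y z : R -> R) (s : R) : R3 := scal (rho y z s) (e1 y z s).
Definition eqN (y z : R -> R) (s : R) : R3 := scal (rho y z s) (e2 y z s).
Definition eqB (y z : R -> R) (s : R) : R3 := scal (rho y z s) (e3 y z s).

Definition eq_curv (y z : R -> R) (s : R) : R := Derive (rho y z) s.
Definition eq_tors (y z : R -> R) (s : R) : R := rho y z s * tau y z s.

Definition eq_curv' (y z : R -> R) (s0 s : R) : R :=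
  Derive_wrt (sigma y z s0) (eq_curv y z) s.
Definition eq_tors' (y z : R -> R) (s0 s : R) : R :=
  Derive_wrt (sigma y z s0) (eq_tors y z) s.

(** ** Weak equiform AW types *)

Definition Q1 (y z : R -> R) (s : R) : R3 :=
  scal (1 / rho y z s ^ 2) (eqN y z s).

Definition Q2 (y z : R -> R) (s : R) : R3 :=
  scal (1 / rho y z s ^ 3)
    (plus (scal (- eq_curv y z s) (eqN y z s))
          (scal (eq_tors y z s) (eqB y z s))).

Definition Q3 (y z : R -> R) (s0 s : R) : R3 :=
  scal (1 / rho y z s ^ 4)
    (plus
      (scal (2 * eq_curv y z s ^ 2 + eq_tors y z s ^ 2 - eq_curv' y z s0 s)
            (eqN y z s))
      (scal (eq_tors' y z s0 s - 3 * eq_curv y z s * eq_tors y z s)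
            (eqB y z s))).

Definition Q1star (y z : R -> R) (s : R) : C3 :=
  pg_normalize (toC3 (Q1 y z s)).

Definition Q2star (y z : R -> R) (s : R) : C3 :=
  let q2 := toC3 (Q2 y z s) in
  let q1s := Q1star y z s in
  pg_normalize (minus q2 (scal (pg_prod q2 q1s) q1s)).

Definition weak_equiform_AW2 (I : R -> Prop) (y z : R -> R) (s0 : R) : Prop :=
  forall s, I s ->
    let q3 := toC3 (Q3 y z s0 s) in
    q3 = scal (pg_prod q3 (Q2star y z s)) (Q2star y z s).

Definition weak_equiform_AW3 (I : R -> Prop) (y z : R -> R) (s0 : R) : Prop :=
  forall s, I s ->
    let q3 := toC3 (Q3 y z s0 s) in
    q3 = scal (pg_prod q3 (Q1star y z s)) (Q1star y z s).

(* Main.v *)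
(* At each point Q1, Q2, Q3 lie in the isotropic plane spanned by the orthogonal
   non-null vectors N and B.  Gram-Schmidt makes Q1* a multiple of N and, since
   the torsion does not vanish on a curve of osculating order 3, Q2* a multiple
   of B.  So AW(2) says that the N-component of Q3 vanishes, and AW(3) that its
   B-component does. *)
Require Import Defs.
From Stdlib Require Import Reals Lra Lia.
From Coquelicot Require Import Coquelicot.
Open Scope R_scope.

Lemma minus_plus_l {G : AbelianGroup} (x y : G) : minus (plus x y) x = y.
Proof.
apply (plus_reg_r x); unfold minus.
transitivity (plus (plus x y) (plus (opp x) x)).
- symmetry; apply plus_assoc.
- rewrite plus_opp_l, plus_zero_r; apply plus_comm.
Qed.

(** * Bilinearity and projections on the isotropic plane *)

(** [pg_prod] is defined by cases and is bilinear only where both first components vanish. This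
    predicate carries that side condition through the algebra below. *)
Definition isotropic (v : C3) : Prop := fst (fst v) = RtoC 0.

Lemma isotropic_scal (c : C) (v : C3) : isotropic v -> isotropic (scal c v).
Proof.
destruct v as [[v1 v2] v3]; unfold isotropic; simpl; intros ->.
apply Cmult_0_r.
Qed.

Lemma isotropic_plus (u v : C3) :
  isotropic u -> isotropic v -> isotropic (plus u v).
Proof.
destruct u as [[u1 u2] u3], v as [[v1 v2] v3]; unfold isotropic; simpl.
intros -> ->; apply Cplus_0_l.
Qed.

Lemma pg_prod_isotropic (u v : C3) : isotropic u -> isotropic v ->
  pg_prod u v = (snd (fst u) * snd (fst v) - snd u * snd v)%C.
Proof.
destruct u as [[u1 u2] u3], v as [[v1 v2] v3]; unfold isotropic; simpl.
intros -> ->; now destruct (Ceq_dec (RtoC 0) (RtoC 0)).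
Qed.

Lemma pg_prod_comm (u v : C3) : isotropic u -> isotropic v ->
  pg_prod u v = pg_prod v u.
Proof. intros; rewrite !pg_prod_isotropic by assumption; ring. Qed.

Lemma pg_prod_scal_l (c : C) (u v : C3) : isotropic u -> isotropic v ->
  pg_prod (scal c u) v = (c * pg_prod u v)%C.
Proof.
intros Hu Hv; rewrite !pg_prod_isotropic by auto using isotropic_scal.
destruct u as [[u1 u2] u3], v as [[v1 v2] v3].
change ((c * u2) * v2 - (c * u3) * v3 = c * (u2 * v2 - u3 * v3))%C; ring.
Qed.

Lemma pg_prod_scal_r (c : C) (u v : C3) : isotropic u -> isotropic v ->
  pg_prod u (scal c v) = (c * pg_prod u v)%C.
Proof.
intros; rewrite pg_prod_comm, pg_prod_scal_l, pg_prod_comm;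
  auto using isotropic_scal.
Qed.

Lemma pg_prod_plus_l (u v w : C3) :
  isotropic u -> isotropic v -> isotropic w ->
  pg_prod (plus u v) w = (pg_prod u w + pg_prod v w)%C.
Proof.
intros Hu Hv Hw; rewrite !pg_prod_isotropic by auto using isotropic_plus.
destruct u as [[u1 u2] u3], v as [[v1 v2] v3], w as [[w1 w2] w3].
change ((u2 + v2) * w2 - (u3 + v3) * w3 =
        (u2 * w2 - u3 * w3) + (v2 * w2 - v3 * w3))%C; ring.
Qed.

(* The two factors [1 / pg_norm v] combine to [1 / pg_prod v v], which removes
   the choice of the square root. *)
Lemma pg_proj_normalize (q v : C3) :
  isotropic q -> isotropic v -> pg_prod v v <> RtoC 0 ->
  scal (pg_prod q (pg_normalize v)) (pg_normalize v)
  = scal (pg_prod q v / pg_prod v v)%C v.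
Proof.
intros Hq Hv Hvv; unfold pg_normalize.
rewrite pg_prod_scal_r by assumption.
assert (Hn : (pg_norm v * pg_norm v)%C = pg_prod v v) by apply Csqrt_sqr.
assert (Hn0 : pg_norm v <> RtoC 0).
{ intros E; apply Hvv; rewrite <- Hn, E; ring. }
rewrite scal_assoc; f_equal; rewrite <- Hn.
change (/ pg_norm v * pg_prod q v * / pg_norm v
        = pg_prod q v / (pg_norm v * pg_norm v))%C.
now field.
Qed.

(** Projection onto a line does not see the length of the spanning vector, so [p] cancels, and
    orthogonality removes the [v] term. The factor [p] is kept because Gram-Schmidt produces only
    multiples of the frame vectors. *)
Lemma pg_proj_orthogonal (u v : C3) (p a b : C) :
  isotropic u -> isotropic v -> pg_prod u u <> RtoC 0 ->
  pg_prod u v = RtoC 0 -> p <> RtoC 0 ->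
  let q := plus (scal a u) (scal b v) in
  let w := pg_normalize (scal p u) in
  scal (pg_prod q w) w = scal a u.
Proof.
intros Hu Hv Huu Huv Hp; cbv zeta.
rewrite pg_proj_normalize; [| auto using isotropic_plus, isotropic_scal .. |].
- rewrite !pg_prod_scal_r, !pg_prod_plus_l, !pg_prod_scal_l, (pg_prod_comm v u),
    Huv by auto using isotropic_plus, isotropic_scal.
  rewrite scal_assoc; f_equal.
  change ((p * (a * pg_prod u u + b * RtoC 0)) / (p * (p * pg_prod u u)) * p
          = a)%C.
  field; auto.
- rewrite pg_prod_scal_r, pg_prod_scal_l by auto using isotropic_scal.
  auto using Cmult_neq_0.
Qed.

(** Pairing [scal c v] with [v] gives [c * pg_prod v v], whose second factor is nonzero. *)
Lemma scal_nonnull_eq0 (c : C) (v : C3) :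
  isotropic v -> pg_prod v v <> RtoC 0 -> scal c v = zero -> c = RtoC 0.
Proof.
intros Hv Hvv E.
destruct (Ceq_dec c (RtoC 0)) as [Hc | Hc]; [exact Hc | exfalso].
apply (Cmult_neq_0 _ _ Hc Hvv).
rewrite <- pg_prod_scal_l, E by assumption.
rewrite pg_prod_isotropic by (assumption || reflexivity).
change ((0 * snd (fst v) - 0 * snd v)%C = RtoC 0); ring.
Qed.

(** The projection of [q] is [scal a u], so the equation reduces to [scal b v = zero], and [v] is
    non-null. Both AW conditions have this form: [u] is N for AW(3) and B for AW(2). *)
Lemma pg_proj_fix_iff (u v : C3) (p a b : C) :
  isotropic u -> isotropic v ->
  pg_prod u u <> RtoC 0 -> pg_prod v v <> RtoC 0 ->
  pg_prod u v = RtoC 0 -> p <> RtoC 0 ->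
  let q := plus (scal a u) (scal b v) in
  let w := pg_normalize (scal p u) in
  q = scal (pg_prod q w) w <-> b = RtoC 0.
Proof.
intros Hu Hv Huu Hvv Huv Hp; cbv zeta.
rewrite pg_proj_orthogonal by assumption.
split; intros E.
- apply (scal_nonnull_eq0 b v Hv Hvv).
  apply (plus_reg_l (scal a u)); now rewrite plus_zero_r.
- rewrite E; rewrite (scal_zero_l v : scal (RtoC 0) v = zero).
  apply plus_zero_r.
Qed.

(** * Transfer from real to complex vectors *)

Lemma toC3_scal (c : R) (v : R3) : toC3 (scal c v) = scal (RtoC c) (toC3 v).
Proof.
destruct v as [[v1 v2] v3].
change ((RtoC (c * v1), RtoC (c * v2), RtoC (c * v3))
  = (RtoC c * RtoC v1, RtoC c * RtoC v2, RtoC c * RtoC v3)%C).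
now rewrite !RtoC_mult.
Qed.

Lemma toC3_plus (u v : R3) : toC3 (plus u v) = plus (toC3 u) (toC3 v).
Proof.
destruct u as [[u1 u2] u3], v as [[v1 v2] v3].
change ((RtoC (u1 + v1), RtoC (u2 + v2), RtoC (u3 + v3))
  = (RtoC u1 + RtoC v1, RtoC u2 + RtoC v2, RtoC u3 + RtoC v3)%C).
now rewrite !RtoC_plus.
Qed.

Lemma toC3_scal_plus (c a b : R) (u v : R3) :
  toC3 (scal c (plus (scal a u) (scal b v)))
  = plus (scal (RtoC (c * a)) (toC3 u)) (scal (RtoC (c * b)) (toC3 v)).
Proof.
rewrite toC3_scal, toC3_plus, !toC3_scal, !RtoC_mult.
transitivity (plus (scal (RtoC c) (scal (RtoC a) (toC3 u)))
                   (scal (RtoC c) (scal (RtoC b) (toC3 v)))).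
- exact (scal_distr_l (RtoC c) (scal (RtoC a) (toC3 u))
           (scal (RtoC b) (toC3 v))).
- now rewrite !scal_assoc.
Qed.

Lemma RtoC_neq0 (r : R) : r <> 0 -> RtoC r <> RtoC 0.
Proof. intros Hr E; apply Hr; now apply RtoC_inj. Qed.

Lemma isotropic_scal_plane (f a b : R) :
  isotropic (toC3 (scal f ((0, a, b) : R3))).
Proof. rewrite toC3_scal; now apply isotropic_scal. Qed.

(** [eqN] and [eqB] both have this doubly scaled shape, with factors [rho] and [1 / kappa], so one
    computation serves all products of frame vectors. *)
Lemma pg_prod_scal_plane (f g a b c d : R) :
  pg_prod (toC3 (scal f (scal g ((0, a, b) : R3))))
          (toC3 (scal f (scal g ((0, c, d) : R3))))
  = RtoC ((f * g) ^ 2 * (a * c - b * d)).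
Proof.
rewrite !toC3_scal.
rewrite !pg_prod_scal_l, !pg_prod_scal_r, pg_prod_isotropic
  by (repeat apply isotropic_scal; reflexivity).
cbn [fst snd toC3]; rewrite <- !RtoC_mult, <- RtoC_minus, <- !RtoC_mult.
f_equal; ring.
Qed.

(** * The equiform frame and the torsion at one point *)

Section AtPoint.

Variables (y z : R -> R) (s : R).
Hypothesis Hneq : Derive_n y 2 s <> Derive_n z 2 s.
Hypothesis Hneqm : Derive_n y 2 s <> - Derive_n z 2 s.

Lemma second_deriv_nonnull : (Derive_n y 2 s) ^ 2 - (Derive_n z 2 s) ^ 2 <> 0.
Proof.
intros E.
assert (E' : (Derive_n y 2 s - Derive_n z 2 s)
             * (Derive_n y 2 s + Derive_n z 2 s) = 0) by (rewrite <- E; ring).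
apply Rmult_integral in E'; lra.
Qed.

Lemma kappa_pos : 0 < kappa y z s.
Proof. apply sqrt_lt_R0, Rabs_pos_lt, second_deriv_nonnull. Qed.

Lemma rho_neq0 : rho y z s <> 0.
Proof.
pose proof kappa_pos; unfold rho.
apply Rgt_not_eq, Rdiv_lt_0_compat; lra.
Qed.

Lemma eps_sqr : eps y z s * eps y z s = 1.
Proof.
unfold eps; set (d := _ - _).
destruct (Rdichotomy d 0 second_deriv_nonnull) as [H | H].
- rewrite sign_eq_m1 by exact H; ring.
- rewrite sign_eq_1 by exact H; ring.
Qed.

Lemma eqN_isotropic : isotropic (toC3 (eqN y z s)).
Proof. unfold eqN; rewrite toC3_scal; apply isotropic_scal, isotropic_scal_plane. Qed.

Lemma eqB_isotropic : isotropic (toC3 (eqB y z s)).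
Proof. unfold eqB; rewrite toC3_scal; apply isotropic_scal, isotropic_scal_plane. Qed.

Let N := toC3 (eqN y z s).
Let B := toC3 (eqB y z s).

Lemma frame_factor_neq0 : (rho y z s * (1 / kappa y z s)) ^ 2 <> 0.
Proof.
apply pow_nonzero; change (1 / kappa y z s) with (rho y z s).
apply Rmult_integral_contrapositive_currified; exact rho_neq0.
Qed.

Lemma eqN_eqN_neq0 : pg_prod N N <> RtoC 0.
Proof.
unfold N, eqN, e2; rewrite pg_prod_scal_plane; apply RtoC_neq0.
apply Rmult_integral_contrapositive_currified; [exact frame_factor_neq0 |].
intros E; apply second_deriv_nonnull; rewrite <- E; ring.
Qed.

Lemma eqB_eqB_neq0 : pg_prod B B <> RtoC 0.
Proof.
unfold B, eqB, e3; rewrite pg_prod_scal_plane; apply RtoC_neq0.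
apply Rmult_integral_contrapositive_currified; [exact frame_factor_neq0 |].
intros E; apply second_deriv_nonnull.
(* B arises from N by exchanging the last two components, which reverses the sign of the form, and
   by a factor [eps] of square 1. Hence the product of B with itself is minus that of N. *)
transitivity (- (eps y z s * eps y z s
                 * (Derive_n z 2 s ^ 2 - Derive_n y 2 s ^ 2))).
- rewrite eps_sqr; ring.
- rewrite <- Ropp_0, <- E; ring.
Qed.

Lemma eqN_eqB_orthogonal : pg_prod N B = RtoC 0.
Proof.
unfold N, B, eqN, eqB, e2, e3; rewrite pg_prod_scal_plane.
f_equal; ring.
Qed.

(** The second and third derivatives of the curve have first component 0, and the numerator of [tau]
    is the determinant of their other two components. If it vanished, these two vectors would be
    dependent. *)
Lemma lin_indep_tau_neq0 :
  lin_indep 3 (fun k => gamma_deriv y z k s) -> tau y z s <> 0.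
Proof.
intros H Ht.
assert (D : Derive_n y 2 s * Derive_n z 3 s
            - Derive_n y 3 s * Derive_n z 2 s = 0).
{ pose proof kappa_pos as K; unfold tau in Ht.
  apply (Rmult_eq_reg_r (/ kappa y z s ^ 2)).
  - rewrite Rmult_0_l; exact Ht.
  - apply Rinv_neq_0_compat, pow_nonzero; lra. }
assert (X1 : forall t, Derive_n (fun t => t) 2 t = 0).
{ intros t; change (Derive (Derive (fun t => t)) t = 0).
  rewrite (Derive_ext _ (fun _ => 1)) by (intros; apply Derive_id).
  apply Derive_const. }
assert (X2 : Derive_n (fun t => t) 3 s = 0).
{ change (Derive (Derive_n (fun t => t) 2) s = 0).
  rewrite (Derive_ext _ (fun _ => 0)) by exact X1; apply Derive_const. }
(* Independence is applied to the coefficients 0, p, q of the first three derivatives. *)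
assert (Comb : forall p q,
  p * Derive_n y 2 s + q * Derive_n y 3 s = 0 ->
  p * Derive_n z 2 s + q * Derive_n z 3 s = 0 -> q = 0).
{ intros p q Hy Hz.
  apply (H (fun i => match i with 2%nat => p | 3%nat => q | _ => 0 end))
    with (i := 3%nat); [| lia].
  rewrite sum_n_Sm, sum_n_Sm, sum_n_n by lia.
  unfold gamma_deriv; rewrite X1, X2.
  change ((0 * Derive_n (fun t => t) 1 s + p * 0 + q * 0,
           0 * Derive_n y 1 s + p * Derive_n y 2 s + q * Derive_n y 3 s,
           0 * Derive_n z 1 s + p * Derive_n z 2 s + q * Derive_n z 3 s)
          = (0, 0, 0)).
  repeat apply (f_equal2 pair); lra. }
(* The vanishing determinant [D] gives two relations: p = y''', q = -y'' and p = z''', q = -z''.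
   They force y'' = z'' = 0, against admissibility. *)
assert (Y0 : - Derive_n y 2 s = 0) by (apply (Comb (Derive_n y 3 s)); lra).
assert (Z0 : - Derive_n z 2 s = 0) by (apply (Comb (Derive_n z 3 s)); lra).
lra.
Qed.

(** * Q1, Q2, Q3 in the frame and the AW conditions at one point *)

Lemma Q1_scal : toC3 (Q1 y z s) = scal (RtoC (1 / rho y z s ^ 2)) N.
Proof. apply toC3_scal. Qed.

Lemma Q2_comb : toC3 (Q2 y z s) =
  plus (scal (RtoC (1 / rho y z s ^ 3 * - eq_curv y z s)) N)
       (scal (RtoC (1 / rho y z s ^ 3 * eq_tors y z s)) B).
Proof. apply toC3_scal_plus. Qed.

Lemma Q3_comb (s0 : R) : toC3 (Q3 y z s0 s) =
  plus
    (scal (RtoC (1 / rho y z s ^ 4 *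
       (2 * eq_curv y z s ^ 2 + eq_tors y z s ^ 2 - eq_curv' y z s0 s))) N)
    (scal (RtoC (1 / rho y z s ^ 4 *
       (eq_tors' y z s0 s - 3 * eq_curv y z s * eq_tors y z s))) B).
Proof. apply toC3_scal_plus. Qed.

Lemma inv_rho_pow_neq0 (n : nat) : 1 / rho y z s ^ n <> 0.
Proof.
unfold Rdiv; rewrite Rmult_1_l.
apply Rinv_neq_0_compat, pow_nonzero, rho_neq0.
Qed.

Lemma inv_rho_pow_mult_eq0_iff (n : nat) (x : R) :
  RtoC (1 / rho y z s ^ n * x) = RtoC 0 <-> x = 0.
Proof.
split; intros E.
- apply RtoC_inj, Rmult_integral in E.
  destruct E as [E | E]; [now apply inv_rho_pow_neq0 in E | exact E].
- now rewrite E, Rmult_0_r.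
Qed.

Lemma Q2star_eqB :
  Q2star y z s
  = pg_normalize (scal (RtoC (1 / rho y z s ^ 3 * eq_tors y z s)) B).
Proof.
unfold Q2star, Q1star; cbv zeta; f_equal.
(* Projecting Q2 on Q1* returns exactly its N-term, so the subtraction leaves the B-term. *)
rewrite Q1_scal, Q2_comb, pg_proj_orthogonal; auto using eqN_isotropic,
  eqB_isotropic, eqN_eqN_neq0, eqN_eqB_orthogonal, RtoC_neq0, inv_rho_pow_neq0.
exact (minus_plus_l (scal _ N) (scal _ B)).
Qed.

Lemma weak_AW3_pointwise (s0 : R) :
  let q3 := toC3 (Q3 y z s0 s) in
  q3 = scal (pg_prod q3 (Q1star y z s)) (Q1star y z s) <->
  eq_tors' y z s0 s - 3 * eq_curv y z s * eq_tors y z s = 0.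
Proof.
cbv zeta; unfold Q1star; rewrite Q1_scal, Q3_comb, pg_proj_fix_iff;
  auto using eqN_isotropic, eqB_isotropic, eqN_eqN_neq0, eqB_eqB_neq0,
    eqN_eqB_orthogonal, RtoC_neq0, inv_rho_pow_neq0.
apply inv_rho_pow_mult_eq0_iff.
Qed.

Lemma weak_AW2_pointwise (s0 : R) : tau y z s <> 0 ->
  let q3 := toC3 (Q3 y z s0 s) in
  q3 = scal (pg_prod q3 (Q2star y z s)) (Q2star y z s) <->
  2 * eq_curv y z s ^ 2 + eq_tors y z s ^ 2 - eq_curv' y z s0 s = 0.
Proof.
(* The summands of Q3 are swapped so that B takes the place of [u]. The scale of B in Q2* contains
   the torsion, so [Ht] makes it nonzero. *)
intros Ht; cbv zeta; rewrite Q2star_eqB, Q3_comb, plus_comm, pg_proj_fix_iff;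
  auto using eqN_isotropic, eqB_isotropic, eqN_eqN_neq0, eqB_eqB_neq0.
- apply inv_rho_pow_mult_eq0_iff.
- rewrite pg_prod_comm; auto using eqN_isotropic, eqB_isotropic,
    eqN_eqB_orthogonal.
- rewrite inv_rho_pow_mult_eq0_iff; unfold eq_tors.
  apply Rmult_integral_contrapositive_currified; auto using rho_neq0.
Qed.

End AtPoint.

Theorem proposition4p1 (I : R -> Prop) (y z : R -> R) (s0 : R)
    (hI : is_interval I) (hs0 : I s0) (hgamma : Frenet_curve3 I y z) :
  (weak_equiform_AW2 I y z s0 <->
   forall s, I s ->
     2 * eq_curv y z s ^ 2 + eq_tors y z s ^ 2 - eq_curv' y z s0 s = 0) /\
  (weak_equiform_AW3 I y z s0 <->
   forall s, I s ->
     eq_tors' y z s0 s - 3 * eq_curv y z s * eq_tors y z s = 0).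
Proof.
destruct hgamma as (_ & _ & Hadm & Hosc).
(* Both equivalences hold at each point separately. [H3], the independence of the first three
   derivatives, supplies the nonzero torsion for AW(2). *)
split; split; intros H s Hs; destruct (Hadm s Hs) as [H1 H2];
  destruct (Hosc s Hs) as [H3 _].
- apply weak_AW2_pointwise; auto using lin_indep_tau_neq0; exact (H s Hs).
- apply weak_AW2_pointwise; auto using lin_indep_tau_neq0.
- apply weak_AW3_pointwise; auto; exact (H s Hs).
- apply weak_AW3_pointwise; auto.
Qed.
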